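(* Let $G_2=(V_2,E_2)$ be the undirected graph with vertex set $V_2=\{1,2,\ldots,8\}$ in which every two distinct vertices are adjacent except for the four pairs $\{1,3\},\{2,4\},\{5,7\},\{6,8\}$; that is, the complement of the edge set is $E_2^c=\{13,24,57,68\}$. Then the completion number of $G_2$ is $2$.
   Context: All graphs are finite, undirected and simple, with vertex set of the form $\{1,\ldots,m\}$. A partial matrix is a matrix in which some entries are specified (complex numbers) and the others are left as free complex variables. A partial matrix $A=\{a_{ij}\}_{i,j=1}^m$ is called partial Hermitian if every diagonal entry $a_{ii}$ is a specified real number, $a_{ij}$ is specified if and only if $a_{ji}$ is specified, and $\overline{a_{ji}}=a_{ij}$ for specified entries. The graph $G=(\{1,\ldots,m\},E)$ is the graph of the partial Hermitian matrix $A$ if, for $i\neq j$, $a_{ij}$ is specified if and only if $(i,j)\in E$. A partial Hermitian matrix $A$ is called partial positive if every fully specified principal submatrix of $A$ (that is, $\{a_{ij}\}_{i,j\in K}$ for every clique $K$ of its graph) is positive semidefinite. A completion of a partial Hermitian matrix $A$ means a (conventional) Hermitian matrix $M$ obtained from $A$ by assigning complex values to all the unspecified entries. For a Hermitian matrix $M$, $i_-(M)$ denotes the number of negative eigenvalues of $M$, counted with multiplicity. The completion number of a graph $G$ is the smallest number $k$ (a nonnegative integer) such that every partial positive matrix $A$ with graph $G$ has a completion $M$ with $i_-(M)\le k$. *)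

(* Defs.v *)
From mathcomp Require Export all_boot all_order all_algebra.
From mathcomp Require Export complex reals.

Set Implicit Arguments.
Unset Strict Implicit.
Unset Printing Implicit Defensive.

Import Order.TTheory GRing.Theory Num.Theory.
Local Open Scope ring_scope.
Local Open Scope sesquilinear_scope.

(* The vertex i : 'I_m stands for the vertex i + 1 of {1, ..., m}. *)
Record sgraph (m : nat) := SGraph {
  adj :> rel 'I_m;
  adj_sym : symmetric adj;
  adj_irrefl : irreflexive adj }.

Section Matrices.
Variable C : numClosedFieldType.

Definition psdmx n (M : 'M[C]_n) : Prop :=
  M \is hermsymmx /\ forall v : 'cV[C]_n, 0 <= (v ^t* *m M *m v) 0 0.

(* The roots of the characteristic polynomial, with multiplicity. *)
Definition eigenvalues n (M : 'M[C]_n) : seq C :=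
  sval (closed_field_poly_normal (char_poly M)).

Lemma char_poly_eigenvalues n (M : 'M[C]_n) :
  char_poly M = \prod_(a <- eigenvalues M) ('X - a%:P).
Proof.
rewrite /eigenvalues; case: closed_field_poly_normal => /= s {1}->.
by rewrite (monicP (char_poly_monic M)) scale1r.
Qed.

(* In the partial order of C, [a < 0] means that a is real and negative. *)
Definition i_minus n (M : 'M[C]_n) : nat := count (fun a => a < 0) (eigenvalues M).

(* A partial matrix: [Some a] is a specified entry, [None] an unspecified one. *)
Definition pmatrix m := 'M[option C]_m.

Definition specified m (A : pmatrix m) (i j : 'I_m) : bool := isSome (A i j).

Definition partial_hermitian m (A : pmatrix m) : Prop :=
  [/\ forall i, exists2 a, A i i = Some a & a \is Num.real,
      forall i j, specified A i j = specified A j i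
    & forall i j a b, A i j = Some a -> A j i = Some b -> b^* = a].

Definition graph_of m (G : sgraph m) (A : pmatrix m) : Prop :=
  forall i j, i != j -> specified A i j = G i j.

(* The default value 0 is irrelevant when the submatrix is fully specified. *)
Definition principal_submx m (A : pmatrix m) (K : {set 'I_m}) : 'M[C]_#|K| :=
  \matrix_(i, j) odflt 0 (A (enum_val i) (enum_val j)).

Definition partial_positive m (A : pmatrix m) : Prop :=
  partial_hermitian A /\
  forall K : {set 'I_m},
    {in K &, forall i j, specified A i j} -> psdmx (principal_submx A K).

Definition completion m (A : pmatrix m) (M : 'M[C]_m) : Prop :=
  M \is hermsymmx /\ forall i j a, A i j = Some a -> M i j = a.

Definition completable_within m (G : sgraph m) (k : nat) : Prop :=
  forall A : pmatrix m, partial_positive A -> graph_of G A ->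
  exists2 M : 'M[C]_m, completion A M & (i_minus M <= k)%N.

Definition is_completion_number m (G : sgraph m) (k : nat) : Prop :=
  completable_within G k /\
  forall k' : nat, completable_within G k' -> (k <= k')%N.

End Matrices.

Definition E2c : seq (nat * nat) := [:: (1, 3); (2, 4); (5, 7); (6, 8)]%N.

(* The labels 1, ..., 8 are the successors of the elements of 'I_8. *)
Definition G2_adj : rel 'I_8 := fun i j =>
  [&& i != j, (i.+1, j.+1) \notin E2c & (j.+1, i.+1) \notin E2c].

Lemma G2_adj_sym : symmetric G2_adj.
Proof. by move=> i j; rewrite /G2_adj eq_sym [X in _ && X]andbC. Qed.

Lemma G2_adj_irrefl : irreflexive G2_adj.
Proof. by move=> i; rewrite /G2_adj eqxx. Qed.

Definition G2 : sgraph 8 := SGraph G2_adj_sym G2_adj_irrefl.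

(* Main.v *)
(* Upper bound.  Complete the entries so that the form has a subspace of
   codimension 2 on which it is positive semidefinite.  Within the cliques
   {1,4,5,8} and {2,3,6,7}, subtract from e_8, e_4 their orthogonal projections
   onto span(e_1, e_5), and from e_7, e_3 those onto span(e_2, e_6), to get n_8,
   n_4, n_7, n_3.  Put n = s8 n_8 + s4 n_4 and n' = t7 n_7 + t3 n_3.  The free
   entries 24, 68 make n orthogonal to e_2, e_6, and the free entries 13, 57 make
   n' orthogonal to e_1, e_5.  On span(e_1, e_2, e_5, e_6, n, n') the form is then
   the clique {1,2,5,6} plus the 2x2 block [[R(s), B(s,t)], [B(s,t)^*, S(t)]],
   where R, S >= 0 are Hermitian forms and B is sesquilinear, all determined by
   the specified entries; s and t can be chosen with |B(s,t)|^2 <= R(s) S(t).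

   Lower bound.  The two 4-cycles induced on {1,2,3,4} and {5,6,7,8} carry the
   data 1, 1, 1, -1 on their edges, with zeros between the two cycles.  Every
   completion has a negative vector in each of the two orthogonal blocks. *)
Require Import Defs.
From mathcomp Require Import ring.

Set Implicit Arguments.
Unset Strict Implicit.
Unset Printing Implicit Defensive.

Import Order.TTheory GRing.Theory Num.Theory.
Local Open Scope ring_scope.
Local Open Scope sesquilinear_scope.

Local Notation "''<' u , v >_ M" := (form Num.conj M u v)
  (at level 0, M at level 2, format "''<' u ,  v >_ M").

(** * Inertia of Hermitian matrices *)

Section Inertia.
Variable C : numClosedFieldType.

Lemma form_conj n (M : 'M[C]_n) u v : M \is hermsymmx ->
  '<v, u>_M = ('<u, v>_M)^*.
Proof.
move=> Mh; have := is_hermitianmxP _ _ _ Mh; rewrite expr0 scale1r => ME.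
have -> : ('<u, v>_M)^* = ((u *m M *m v^t*)^t*) 0 0.
  by rewrite [RHS]mxE; congr (_^*); rewrite [RHS]mxE.
by rewrite !trmx_mul !map_mxM trmxCK /form -ME mulmxA.
Qed.

Lemma form_real n (M : 'M[C]_n) u : M \is hermsymmx -> '<u, u>_M \is Num.real.
Proof. by move=> Mh; rewrite CrealE -form_conj. Qed.

Lemma mulmx_ker_neq0 m k (X : 'M[C]_(m, k)) : (k < m)%N ->
  exists2 u : 'rV_m, u != 0 & u *m X = 0.
Proof.
move=> km; have : kermx X != 0.
  rewrite kermx_eq0 /row_free neq_ltn (leq_ltn_trans (rank_leq_col X) km) //.
case/rowV0Pn => u /sub_kermxP uX u0; by exists u.
Qed.

Local Notation sd := spectral_diag.

(** By unitary diagonalisation [M] is similar to the diagonal matrix of [sd M]. The characteristic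
    polynomials agree, hence so do the multisets of roots. *)
Lemma i_minusE n (M : 'M[C]_n) : M \is hermsymmx ->
  i_minus M = #|[pred i | sd M 0 i < 0]|.
Proof.
move=> /hermitian_normalmx /orthomx_spectralP ME.
have cp : char_poly M = \prod_(a <- [seq sd M 0 i | i : 'I_n]) ('X - a%:P).
  rewrite big_image /=.
  set P := spectralmx M in ME; have Pu : P \in unitmx by exact: spectral_unit.
  transitivity (char_poly (diag_mx (sd M))); last first.
    rewrite char_poly_trig ?diag_mx_is_trig //.
    by apply: eq_bigr => i _; rewrite !mxE eqxx.
  rewrite /char_poly.
  have -> : char_poly_mx M = map_mx polyC (invmx P) *m
      char_poly_mx (diag_mx (sd M)) *m map_mx polyC P.
    rewrite /char_poly_mx mulmxBr mulmxBl -!map_mxM {1}ME; congr (_ - _).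
    by rewrite scalar_mxC -mulmxA -map_mxM mulVmx // map_mx1 mulmx1.
  by rewrite !det_mulmx mulrAC -det_mulmx -map_mxM mulVmx // map_mx1 det1 mul1r.
have pe : perm_eq (eigenvalues M) [seq sd M 0 i | i : 'I_n].
  by apply: prod_XsubC_eq; rewrite -char_poly_eigenvalues cp.
rewrite /i_minus (permP pe) count_map cardE /enum_mem size_filter.
by rewrite count_filter; apply: eq_count => i; rewrite !inE andbT.
Qed.

Lemma form_spectral n (M : 'M[C]_n) (v : 'rV_n) : M \is hermsymmx ->
  '<v, v>_M = \sum_i sd M 0 i * `|(v *m (spectralmx M)^t*) 0 i| ^+ 2.
Proof.
move=> /hermitian_normalmx /orthomx_spectralP {1}->.
rewrite invmx_unitary ?spectral_unitarymx // /form.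
set P := spectralmx M; rewrite !mulmxA -(mulmxA _ P).
have -> : P *m v^t* = (v *m P^t*)^t* by rewrite trmx_mul map_mxM trmxCK.
set y := v *m _; rewrite mul_mx_diag !mxE; apply: eq_bigr => i _.
by rewrite !mxE normCK mulrAC mulrC mulrA.
Qed.

(** With fewer than [m] negative eigenvalues, some nonzero [u] would make [u *m W] orthogonal to all
    the negative eigenvectors, and the form would be nonnegative there. *)
Lemma leq_i_minus n m (M : 'M[C]_n) (W : 'M_(m, n)) : M \is hermsymmx ->
  (forall u, u != 0 -> '<u *m W, u *m W>_M < 0) -> (m <= i_minus M)%N.
Proof.
move=> Mh Wneg; rewrite i_minusE //; set S := [pred i | _].
rewrite leqNgt; apply/negP => ltSm.
pose Q := colsub (@enum_val _ S) ((spectralmx M)^t*).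
have [u u0 uX] := mulmx_ker_neq0 (W *m Q) ltSm.
have := Wneg u u0; rewrite form_spectral // => /lt_geF/negbT/negP[].
apply: sumr_ge0 => i _.
have [iS|] := boolP (i \in S); last first.
  rewrite inE => /negbTE neg; apply: mulr_ge0; rewrite ?exprn_ge0 //.
  have /mxOverP/(_ 0 i) := hermitian_spectral_diag_real Mh.
  by move=> sr; rewrite real_leNgt ?real0 ?neg.
have /matrixP/(_ 0 (enum_rank_in iS i)) := uX.
rewrite mulmxA mulmx_colsub [LHS]mxE [RHS]mxE enum_rankK_in // => ->.
by rewrite normr0 expr0n mulr0.
Qed.

(** The columns of [L] are [k] linear equations. With more than [k] negative eigenvalues, the span
    of their eigenvectors would contain a nonzero solution, at which the form is negative. *)
Lemma i_minus_leq n k (M : 'M[C]_n) (L : 'M_(n, k)) : M \is hermsymmx ->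
  (forall v, v *m L = 0 -> 0 <= '<v, v>_M) -> (i_minus M <= k)%N.
Proof.
move=> Mh Lpos; rewrite i_minusE //; set S := [pred i | _].
rewrite leqNgt; apply/negP => ltkS.
pose Q := colsub (@enum_val _ [predC S]) ((spectralmx M)^t*).
have ltn : (#|[predC S]| + k < n)%N.
  by rewrite -[X in (_ < X)%N]card_ord -(cardC S) addnC ltn_add2r.
have [v v0] := mulmx_ker_neq0 (row_mx Q L) ltn.
rewrite mul_mx_row -row_mx0 => /eq_row_mx[vQ vL].
have yS i : i \notin S -> (v *m (spectralmx M)^t*) 0 i = 0.
  move=> iS; have iS' : i \in [predC S] by [].
  have /matrixP/(_ 0 (enum_rank_in iS' i)) := vQ.
  by rewrite mulmx_colsub [LHS]mxE [RHS]mxE enum_rankK_in.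
have := Lpos v vL; rewrite form_spectral // => sge0.
(* A nonnegative sum of nonpositive terms has only zero terms, which kills the coordinates along the
   negative eigenvectors too. *)
have tle0 i : sd M 0 i * `|(v *m (spectralmx M)^t*) 0 i| ^+ 2 <= 0.
  have [iS|/yS->] := boolP (i \in S); last by rewrite normr0 expr0n mulr0.
  by rewrite mulr_le0_ge0 ?exprn_ge0 // ltW.
have y0 : v *m ((spectralmx M)^t*) = 0.
  apply/rowP => i; rewrite [RHS]mxE; have [iS|/yS->//] := boolP (i \in S).
  have s0 : \sum_i - (sd M 0 i * `|(v *m ((spectralmx M)^t*)) 0 i| ^+ 2) = 0.
    by apply/eqP; rewrite sumrN oppr_eq0 eq_le sge0 andbT sumr_le0.
  have /eqP : - (sd M 0 i * `|(v *m ((spectralmx M)^t*)) 0 i| ^+ 2) = 0.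
    by apply: (psumr_eq0P _ s0) => // j _; rewrite oppr_ge0.
  by rewrite oppr_eq0 mulf_eq0 (lt_eqF iS) expf_eq0 normr_eq0 => /eqP.
move: v0; rewrite -(mulmxKtV v (spectral_unitarymx M) (erefl _)) y0.
by rewrite mul0mx eqxx.
Qed.

End Inertia.

(** * Positive semidefiniteness on coordinate subspaces *)

Section Forms.
Variable C : numClosedFieldType.

(** For isotropic [e] the value at [z *: e + g] is ['<g, g>_M] plus twice the real part of
    [z * '<e, g>_M], so it takes every real value. The chosen [z] gives -1. *)
Lemma form_lt0 n (M : 'M[C]_n) e g : M \is hermsymmx ->
  '<e, e>_M = 0 -> '<e, g>_M != 0 ->
  exists z, '<z *: e + g, z *: e + g>_M < 0.
Proof.
move=> Mh e0 eg; exists (- ('<g, g>_M + 1) / (2 * '<e, g>_M)).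
set z := _ / _; rewrite !(formDl, formDr, formZl, formZr) e0 (form_conj e g) //.
rewrite mulr0 add0r.
have -> : z * '<e, g>_M = - ('<g, g>_M + 1) / 2 by rewrite /z; field.
have -> : z^* * ('<e, g>_M)^* = - ('<g, g>_M + 1) / 2.
  rewrite -rmorphM /z.
  have -> : - ('<g, g>_M + 1) / (2 * '<e, g>_M) * '<e, g>_M
     = - ('<g, g>_M + 1) / 2 by field.
  apply/CrealP; rewrite rpredM ?rpredN ?rpredD ?rpredV ?realn ?rpred1 //.
  exact: form_real.
set q : C := '<g, g>_M.
suff -> : - (q + 1) / 2 + (- (q + 1) / 2 + q) = -1 by rewrite oppr_lt0.
by field.
Qed.

Lemma leq2_i_minus n (M : 'M[C]_n) (u v : 'rV_n) : M \is hermsymmx ->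
  '<u, v>_M = 0 -> '<u, u>_M < 0 -> '<v, v>_M < 0 -> (2 <= i_minus M)%N.
Proof.
move=> Mh uv u0 v0; have vu : '<v, u>_M = 0 by rewrite (form_conj u) // uv rmorph0.
apply: (@leq_i_minus _ _ (1 + 1) _ (col_mx u v)) => // w.
rewrite -[w]hsubmxK mul_row_col; set a := lsubmx w; set b := rsubmx w => w0.
rewrite [a]mx11_scalar [b]mx11_scalar !mul_scalar_mx.
rewrite !(formDl, formDr, formZl, formZr) uv vu !mulr0 addr0 add0r !mulrA -!normCK.
have [a0|a0] := eqVneq (a 0 0) 0; last first.
  rewrite -[X in _ < X]addr0; apply: ltr_leD.
    by rewrite pmulr_rlt0 ?exprn_gt0 ?normr_gt0.
  by rewrite mulr_ge0_le0 ?exprn_ge0 // ltW.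
rewrite a0 normr0 expr0n mul0r add0r pmulr_rlt0 ?exprn_gt0 ?normr_gt0 //.
apply: contraNneq w0 => b0.
by rewrite [a]mx11_scalar [b]mx11_scalar a0 b0 !raddf0 row_mx0.
Qed.

Definition supported n (K : {set 'I_n}) (v : 'rV[C]_n) :=
  forall i, i \notin K -> v 0 i = 0.

Definition psd_on n (M : 'M[C]_n) (K : {set 'I_n}) :=
  forall v, supported K v -> 0 <= '<v, v>_M.

Lemma supportedD n (K : {set 'I_n}) u v :
  supported K u -> supported K v -> supported K (u + v).
Proof. by move=> uK vK i iK; rewrite mxE uK // vK // addr0. Qed.

Lemma supportedZ n (K : {set 'I_n}) a u : supported K u -> supported K (a *: u).
Proof. by move=> uK i iK; rewrite mxE uK // mulr0. Qed.

Lemma supportedN n (K : {set 'I_n}) u : supported K u -> supported K (- u).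
Proof. by move=> uK i iK; rewrite mxE uK // oppr0. Qed.

Lemma supportedB n (K : {set 'I_n}) u v :
  supported K u -> supported K v -> supported K (u - v).
Proof. by move=> uK vK; apply/supportedD/supportedN. Qed.

Lemma supported_delta n (K : {set 'I_n}) i : i \in K -> supported K 'e_i.
Proof.
move=> iK j jK; rewrite mxE eqxx /=; case: eqP => // ji.
by rewrite ji iK in jK.
Qed.

Definition quad n (a b c d : 'I_n) := [set i in [:: a; b; c; d]].

Lemma all_quad n (a b c d : 'I_n) (P : 'I_n -> Prop) :
  P a -> P b -> P c -> P d -> {in quad a b c d, forall i, P i}.
Proof. by move=> ? ? ? ? i; rewrite !inE => /or4P[]/eqP->. Qed.

Lemma supported_quad n (a b c d i : 'I_n) :
  i \in [:: a; b; c; d] -> supported (quad a b c d) 'e_i.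
Proof. by move=> iK; apply: supported_delta; rewrite inE. Qed.

Lemma form_row n (M : 'M[C]_n) u v :
  '<u, v>_M = \sum_j '<u, 'e_j>_M * (v 0 j)^*.
Proof.
rewrite {1}/form mxE; apply: eq_bigr => j _; congr (_ * _); last by rewrite !mxE.
rewrite /form; have -> : ('e_j : 'rV[C]_n)^t* = delta_mx j 0.
  by apply/matrixP => k l; rewrite !mxE rmorph_nat andbC.
by rewrite -colE !mxE.
Qed.

Lemma form_supported0 n (M : 'M[C]_n) (K : {set 'I_n}) u w : supported K w ->
  {in K, forall j, '<u, 'e_j>_M = 0} -> '<u, w>_M = 0.
Proof.
move=> wK u0; rewrite form_row big1 // => j _.
have [/u0->|/wK->] := boolP (j \in K); first by rewrite mul0r.
by rewrite rmorph0 mulr0.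
Qed.

Lemma form_add_orthogonal n (M : 'M[C]_n) u w : M \is hermsymmx ->
  '<u, w>_M = 0 -> '<w + u, w + u>_M = '<w, w>_M + '<u, u>_M.
Proof.
move=> Mh uw; rewrite formDl !formDr uw (form_conj u) // uw rmorph0.
by rewrite addr0 add0r.
Qed.

(** If the product were nonzero, [form_lt0] would give a negative vector supported on [K]. *)
Lemma psd_on_isotropic n (M : 'M[C]_n) K u v : M \is hermsymmx -> psd_on M K ->
  supported K u -> supported K v -> '<u, u>_M = 0 -> '<u, v>_M = 0.
Proof.
move=> Mh Mpos uK vK u0; apply/eqP/negPn/negP => uv.
have [z] := form_lt0 Mh u0 uv; apply/negP; rewrite le_gtF //.
exact/Mpos/supportedD/vK/supportedZ.
Qed.

Lemma psd_on_project n (M : 'M[C]_n) K u v : M \is hermsymmx -> psd_on M K ->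
  supported K u -> supported K v -> exists c, '<v - c *: u, u>_M = 0.
Proof.
move=> Mh Mpos uK vK; have [u0|u0] := eqVneq '<u, u>_M 0.
  exists 0; rewrite scale0r subr0 (form_conj u) //.
  by rewrite (psd_on_isotropic Mh Mpos) // rmorph0.
exists ('<v, u>_M / '<u, u>_M).
by rewrite formDl formNl formZl divfK // subrr.
Qed.

(** Gram-Schmidt: project along [u1], then along [u2] made orthogonal to [u1]. A singular Gram
    matrix is harmless, since isotropic vectors are already orthogonal to everything supported on
    [K]. *)
Lemma psd_on_project2 n (M : 'M[C]_n) K u1 u2 v : M \is hermsymmx ->
  psd_on M K -> supported K u1 -> supported K u2 -> supported K v ->
  exists c1 c2, let w := v - (c1 *: u1 + c2 *: u2) in
    '<w, u1>_M = 0 /\ '<w, u2>_M = 0.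
Proof.
move=> Mh Mpos u1K u2K vK.
have [c c0] := psd_on_project Mh Mpos u1K u2K.
have [d d0] := psd_on_project Mh Mpos u1K vK.
have wK : supported K (v - d *: u1) by apply/supportedB/supportedZ.
have uK : supported K (u2 - c *: u1) by apply/supportedB/supportedZ.
have [e e0] := psd_on_project Mh Mpos uK wK.
exists (d - e * c), e.
have -> : v - ((d - e * c) *: u1 + e *: u2) = v - d *: u1 - e *: (u2 - c *: u1).
  rewrite scalerBl scalerBr scalerA !opprD !opprK -!addrA.
  by rewrite [- (e *: u2) + _]addrC.
set w := v - _ - _.
have w1 : '<w, u1>_M = 0 by rewrite /w formDl formNl formZl d0 c0 mulr0 subr0.
split=> //; rewrite -[u2](subrK (c *: u1)) formDr formZr w1 mulr0 addr0.
exact: e0.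
Qed.

End Forms.

(** * Binary Hermitian forms *)

Section BinaryForms.
Variable C : numClosedFieldType.
Implicit Types r s b x y : C.

(** The value at [(x, y)] of the Hermitian form with Gram matrix [[r, b], [b^*, s]]. *)
Definition herm2 r s b x y : C :=
  x * x^* * r + x * y^* * b + y * x^* * b^* + y * y^* * s.

Lemma herm2_ge0 r s b x y : 0 <= r -> 0 <= s -> `|b| ^+ 2 <= r * s ->
  0 <= herm2 r s b x y.
Proof.
move=> r0 s0 bs; rewrite /herm2; have [r1|r1] := eqVneq r 0.
  have /eqP : `|b| ^+ 2 = 0.
    by apply/eqP; rewrite eq_le exprn_ge0 // andbT (le_trans bs) // r1 mul0r.
  rewrite expf_eq0 normr_eq0 => /eqP ->.
  by rewrite rmorph0 r1 !mulr0 !add0r -normCK mulr_ge0 ?exprn_ge0.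
have rp : 0 < r by rewrite lt_def r1.
rewrite -(pmulr_rge0 _ rp).
have rE : r^* = r by apply/CrealP; rewrite ger0_real.
(* Complete the square, after multiplying by the positive [r]. *)
have -> : r * (x * x^* * r + x * y^* * b + y * x^* * b^* + y * y^* * s) =
  `|x * r + y * b^*| ^+ 2 + `|y| ^+ 2 * (r * s - `|b| ^+ 2).
  by rewrite !normCK !(rmorphD, rmorphM) /= conjCK rE; ring.
by rewrite addr_ge0 ?exprn_ge0 // mulr_ge0 ?exprn_ge0 // subr_ge0.
Qed.

Lemma form_herm2 n (M : 'M[C]_n) u v x y : M \is hermsymmx ->
  '<x *: u + y *: v, x *: u + y *: v>_M =
  herm2 '<u, u>_M '<v, v>_M '<u, v>_M x y.
Proof.
move=> Mh; rewrite /herm2 !(formDl, formDr, formZl, formZr) (form_conj u v) //.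
by ring.
Qed.

Definition psd2 r s b := forall x y, 0 <= herm2 r s b x y.

Lemma herm2C r s b x y : herm2 r s b x y = herm2 s r b^* y x.
Proof. by rewrite /herm2 conjCK; ring. Qed.

Lemma psd2C r s b : psd2 r s b -> psd2 s r b^*.
Proof. by move=> pos x y; rewrite herm2C conjCK. Qed.

Lemma psd2_diag r s b : psd2 r s b -> 0 <= r /\ 0 <= s.
Proof.
move=> pos; have := pos 1 0; have := pos 0 1; rewrite /herm2 rmorph0 rmorph1.
by rewrite !(mulr0, mul0r, mulr1, mul1r, addr0, add0r) => ? ?; split.
Qed.

(* The mean of the values at [y] and [- y] is [r + `|y| ^+ 2 * s]. *)
Lemma herm2_sign r s b y : psd2 r s b ->
  exists2 e : C, (e = y \/ e = - y) & r + `|y| ^+ 2 * s <= herm2 r s b 1 e.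
Proof.
move=> pos.
have E : herm2 r s b 1 y - (r + `|y| ^+ 2 * s) =
    - (herm2 r s b 1 (- y) - (r + `|y| ^+ 2 * s)).
  by rewrite /herm2 normCK !(rmorphN, rmorph1) /=; ring.
have [r0 s0] := psd2_diag pos.
have wr : r + `|y| ^+ 2 * s \is Num.real.
  by rewrite ger0_real // addr_ge0 // mulr_ge0 ?exprn_ge0.
have [le|lt] := real_leP wr (ger0_real (pos 1 y)).
  by exists y; first by left.
exists (- y); first by right.
by rewrite -subr_ge0 -oppr_le0 -E subr_le0 ltW.
Qed.

(* A vanishing coordinate kills the coefficient of one of the two free entries;
   the orthogonality which that entry should produce then has to come from the
   isotropy of the remaining basis vector. *)
Definition admissible r s x y :=
  [/\ (x != 0) || (y != 0), y = 0 -> r = 0 & x = 0 -> s = 0].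

Lemma admissible_neq0 r s x y : x != 0 -> y != 0 -> admissible r s x y.
Proof.
move=> x0 y0; split; rewrite ?x0 // => /eqP.
  by rewrite (negbTE y0).
by rewrite (negbTE x0).
Qed.

Lemma admissibleC r s x y : admissible r s x y -> admissible s r y x.
Proof. by case=> xy y0 x0; split=> //; rewrite orbC. Qed.

Definition bilin2 (B : C * C * C * C) x1 x2 y1 y2 : C :=
  let: (b11, b12, b21, b22) := B in
  x1 * y1^* * b11 + x1 * y2^* * b12 + x2 * y1^* * b21 + x2 * y2^* * b22.

Definition dominated r1 r2 b s1 s2 c B := exists x1 x2 y1 y2,
  [/\ admissible r1 r2 x1 x2, admissible s1 s2 y1 y2 &
    `|bilin2 B x1 x2 y1 y2| ^+ 2 <= herm2 r1 r2 b x1 x2 * herm2 s1 s2 c y1 y2].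

(** With a zero second column a kernel vector [y] would have [y1 = 0], which is admissible only if
    [s2 = 0]. Otherwise either [x] annihilates the first column, or the right-hand side is made
    large. *)
Lemma dominated_col r1 r2 b s1 s2 c b11 b21 :
  psd2 r1 r2 b -> psd2 s1 s2 c -> dominated r1 r2 b s1 s2 c (b11, 0, b21, 0).
Proof.
move=> rpos spos; have [r10 r20] := psd2_diag rpos; have [s10 s20] := psd2_diag spos.
have zero x1 x2 y1 y2 : bilin2 (b11, 0, b21, 0) x1 x2 y1 y2 = 0 ->
    `|bilin2 (b11, 0, b21, 0) x1 x2 y1 y2| ^+ 2 <=
      herm2 r1 r2 b x1 x2 * herm2 s1 s2 c y1 y2.
  by move->; rewrite normr0 expr0n mulr_ge0.
(* [y2] does not enter [bilin2]: if [s2] and [r1 + r2] are nonzero, take it large. *)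
have [s2z|s2n] := eqVneq s2 0.
  exists 1, 1, 0, 1; split; first by apply: admissible_neq0; rewrite oner_eq0.
    by split; rewrite ?oner_eq0 ?orbT // => /eqP; rewrite oner_eq0.
  by apply: zero; rewrite /bilin2 rmorph0; ring.
have [rz|rn] := eqVneq (r1 + r2) 0.
  have /andP[/eqP r1z /eqP r2z] : (r1 == 0) && (r2 == 0) by rewrite -paddr_eq0 // rz.
  (* As [r1 = r2 = 0], any nonzero [x] is admissible, in particular one that annihilates the first
     column. *)
  have [x1 [x2 [xn xB]]] : exists x1 x2 : C,
      (x1 != 0) || (x2 != 0) /\ x1 * b11 + x2 * b21 = 0.
    have [bz|bn] := eqVneq b11 0.
      by exists 1, 0; rewrite oner_eq0 bz mulr0 mul0r addr0.
    by exists (- b21), b11; rewrite bn orbT; split=> //; ring.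
  exists x1, x2, 1, 1; split; first by split.
    by apply: admissible_neq0; rewrite oner_eq0.
  by apply: zero; rewrite /bilin2 rmorph1 !mulr0 !addr0 !mulr1.
have [x2 x2E Rge] := herm2_sign 1 rpos; set R := herm2 _ _ _ _ _ in Rge.
have Rp : 0 < R.
  apply: lt_le_trans Rge; rewrite normr1 expr1n mul1r lt_def rn.
  by rewrite addr_ge0.
have s2p : 0 < s2 by rewrite lt_def s2n.
set v := `|b11 + x2 * b21| ^+ 2.
(* Then [v = R * (k * s2)]. Taking [y2] to be [1 + k] up to sign makes the second factor at least
   [(1 + k) ^+ 2 * s2], which exceeds [k * s2]; the shift by 1 keeps [y2] nonzero. *)
pose k := v / (R * s2).
have k0 : 0 <= k by rewrite divr_ge0 ?exprn_ge0 // mulr_ge0 // ltW.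
have [y2 y2E Sge] := herm2_sign (1 + k) spos.
have k1 : 1 + k != 0 by rewrite gt_eqF // ltr_wpDr.
exists 1, x2, 1, y2; split.
- apply: admissible_neq0; first by rewrite oner_eq0.
  by case: x2E => ->; rewrite ?oppr_eq0 oner_eq0.
- apply: admissible_neq0; first by rewrite oner_eq0.
  by case: y2E => ->; rewrite ?oppr_eq0.
rewrite /bilin2 rmorph1 !mulr0 !addr0 !mulr1 mul1r -/v -/R.
have -> : v = R * (k * s2) by rewrite /k; field; rewrite !gt_eqF.
rewrite ler_pM2l //; apply: le_trans Sge.
rewrite ler_wpDl // ler_pM2r // ger0_norm ?addr_ge0 //.
rewrite -subr_ge0.
have -> : (1 + k) ^+ 2 - k = 1 + k + k ^+ 2 by ring.
by rewrite !addr_ge0 ?exprn_ge0.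
Qed.

Lemma dominatedC r1 r2 b s1 s2 c b11 b12 b21 b22 :
  dominated r1 r2 b s2 s1 c^* (b12, b11, b22, b21) ->
  dominated r1 r2 b s1 s2 c (b11, b12, b21, b22).
Proof.
case=> x1 [x2 [y1 [y2 [xa ya le]]]]; exists x1, x2, y2, y1; split=> //.
  exact: admissibleC.
rewrite [herm2 s1 _ _ _ _]herm2C.
suff -> : bilin2 (b11, b12, b21, b22) x1 x2 y2 y1 =
  bilin2 (b12, b11, b22, b21) x1 x2 y1 y2 by [].
by rewrite /bilin2; ring.
Qed.

Lemma affine_root2 (a b t u : C) : t != u ->
  a + t * b = 0 -> a + u * b = 0 -> a = 0 /\ b = 0.
Proof.
move=> tu at0 au0; have b0 : b = 0.
  have /eqP : (t - u) * b = 0.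
    by rewrite -[RHS](subrr 0) -{1}at0 -au0; ring.
  by rewrite mulf_eq0 subr_eq0 (negbTE tu) => /eqP.
by split=> //; rewrite -at0 b0 mulr0 addr0.
Qed.

(** If both columns of [B] are nonzero, a generic [x] has a product with [B] whose two entries are
    nonzero. A vector [y] annihilating it then has nonzero coordinates, and the left-hand side is
    0. *)
Lemma psd2_dominated r1 r2 b s1 s2 c B :
  psd2 r1 r2 b -> psd2 s1 s2 c -> dominated r1 r2 b s1 s2 c B.
Proof.
case: B => [[[b11 b12] b21] b22] rpos spos.
have [/andP[/eqP-> /eqP->]|c2] := boolP ((b12 == 0) && (b22 == 0)).
  exact: dominated_col.
have [/andP[/eqP-> /eqP->]|c1] := boolP ((b11 == 0) && (b21 == 0)).
  by apply/dominatedC/dominated_col => //; apply: psd2C.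
have nz p q (t u : C) : ~~ ((p == 0) && (q == 0)) -> t != u ->
    p + t * q = 0 -> p + u * q != 0.
  move=> pq tu pt; apply: contraNneq pq => pu.
  by have [-> ->] := affine_root2 tu pt pu; rewrite eqxx.
have nat_neq i j : i != j -> i%:R != j%:R :> C by rewrite eqr_nat.
(* Each of the two affine functions of [t] has at most one root, so one of 1, 2, 3 avoids both. *)
have [t [t0 t1 t2]] : exists t : C, [/\ t != 0, b11 + t * b21 != 0 & b12 + t * b22 != 0].
  have n12 := nat_neq 1%N 2%N isT; have n13 := nat_neq 1%N 3%N isT.
  have n23 := nat_neq 2%N 3%N isT.
  have [p1|p1] := eqVneq (b11 + 1%:R * b21) 0.
    have p2 := nz _ _ _ _ c1 n12 p1; have p3 := nz _ _ _ _ c1 n13 p1.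
    have [q2|q2] := eqVneq (b12 + 2%:R * b22) 0; last by exists 2%:R; rewrite pnatr_eq0.
    by exists 3%:R; rewrite pnatr_eq0 (nz _ _ _ _ c2 n23 q2).
  have [q1|q1] := eqVneq (b12 + 1%:R * b22) 0; last by exists 1%:R; rewrite pnatr_eq0.
  have q2 := nz _ _ _ _ c2 n12 q1; have q3 := nz _ _ _ _ c2 n13 q1.
  have [p2|p2] := eqVneq (b11 + 2%:R * b21) 0; last by exists 2%:R; rewrite pnatr_eq0.
  by exists 3%:R; rewrite pnatr_eq0 (nz _ _ _ _ c1 n23 p2).
exists 1, t, (b12 + t * b22)^*, (- (b11 + t * b21))^*; split.
- by apply: admissible_neq0; rewrite ?oner_eq0.
- by apply: admissible_neq0; rewrite conjC_eq0 ?oppr_eq0.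
rewrite [bilin2 _ _ _ _ _](_ : _ = 0) ?normr0 ?expr0n ?mulr_ge0 //.
by rewrite /bilin2 !conjCK; ring.
Qed.

End BinaryForms.

(** * Completions of partial matrices *)

Section Completion.
Variable C : numClosedFieldType.

Lemma supported_rowsub n (K : {set 'I_n}) (v : 'rV[C]_n) : supported K v ->
  v = colsub (@enum_val _ (mem K)) v *m rowsub (@enum_val _ (mem K)) 1%:M.
Proof.
move=> vK; apply/rowP => j; rewrite mxE.
under eq_bigr => k _ do rewrite !mxE.
rewrite -(big_enum_val (fun i => v 0 i * (i == j)%:R)) /=.
have [jK|jK] := boolP (j \in K); last first.
  rewrite vK // big1 // => i iK; case: eqP => [ij|_]; last by rewrite mulr0.
  by rewrite ij (negbTE jK) in iK.
rewrite (bigD1 j) //= eqxx mulr1 big1 ?addr0 // => i /andP[_ /negbTE->].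
by rewrite mulr0.
Qed.

Lemma mxsub_form n (M : 'M[C]_n) (K : {set 'I_n}) (u : 'rV[C]_#|K|) :
  (u *m mxsub (@enum_val _ (mem K)) (@enum_val _ (mem K)) M *m u^t*) 0 0 =
  '<u *m rowsub (@enum_val _ (mem K)) 1%:M, u *m rowsub (@enum_val _ (mem K)) 1%:M>_M.
Proof.
rewrite /form; set S := rowsub _ 1%:M; rewrite trmx_mul map_mxM !mulmxA.
suff -> : mxsub (@enum_val _ (mem K)) (@enum_val _ (mem K)) M = S *m M *m S^t*.
  by rewrite !mulmxA.
have -> : S^t* = colsub (@enum_val _ (mem K)) 1%:M.
  by apply/matrixP => i j; rewrite !mxE rmorph_nat eq_sym.
by rewrite mulmx_colsub mulmx1 mul_rowsub_mx mul1mx; apply/matrixP => i j; rewrite !mxE.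
Qed.

Lemma rowsub_supported n (K : {set 'I_n}) (u : 'rV[C]_#|K|) :
  supported K (u *m rowsub (@enum_val _ (mem K)) 1%:M).
Proof.
move=> i iK; rewrite mxE big1 // => k _; rewrite !mxE.
by case: eqP => [ki|_]; [rewrite -ki enum_valP in iK | rewrite mulr0].
Qed.

Lemma clique_psd_on m (A : pmatrix C m) M (K : {set 'I_m}) :
  partial_positive A -> completion A M ->
  {in K &, forall i j, specified A i j} -> psd_on M K.
Proof.
move=> [_ Apos] [_ AM] Kcl v vK.
have [_ /(_ ((colsub (@enum_val _ (mem K)) v)^t*))] := Apos K Kcl.
have -> : principal_submx A K = mxsub (@enum_val _ (mem K)) (@enum_val _ (mem K)) M.
  apply/matrixP => i j; rewrite !mxE.
  have := Kcl _ _ (enum_valP i) (enum_valP j); rewrite /specified.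
  by case E: (A _ _) => [a|] //= _; rewrite (AM _ _ _ E).
by rewrite trmxCK mxsub_form -supported_rowsub.
Qed.

Definition fill m (A : pmatrix C m) : 'M[C]_m := \matrix_(i, j) odflt 0 (A i j).

Lemma fill_hermitian m (A : pmatrix C m) : partial_hermitian A -> fill A \is hermsymmx.
Proof.
move=> [_ Asym Aconj]; rewrite is_hermitianmxE expr0 scale1r.
apply/eqP/matrixP => i j; rewrite !mxE.
have := Asym i j; rewrite /specified.
case Eij: (A i j) => [a|]; case Eji: (A j i) => [b|] //= _; last by rewrite rmorph0.
by rewrite (Aconj _ _ _ _ Eij Eji).
Qed.

Lemma hermitianD n (M N : 'M[C]_n) : M \is hermsymmx -> N \is hermsymmx ->
  M + N \is hermsymmx.
Proof.
rewrite !is_hermitianmxE expr0 !scale1r => /eqP ME /eqP NE.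
by rewrite linearD map_mxD -ME -NE.
Qed.

Lemma fill_completion m (A : pmatrix C m) (Y : 'M[C]_m) : partial_hermitian A ->
  Y \is hermsymmx -> (forall i j, specified A i j -> Y i j = 0) ->
  completion A (fill A + Y).
Proof.
move=> Ah Yh Y0; split; first by rewrite hermitianD ?fill_hermitian.
by move=> i j a E; rewrite !mxE E /= Y0 ?addr0 // /specified E.
Qed.

Lemma form_addmx n (M N : 'M[C]_n) u v : '<u, v>_(M + N) = '<u, v>_M + '<u, v>_N.
Proof. by rewrite /form mulmxDr mulmxDl mxE. Qed.

Definition herm_delta n (x : C) (i j : 'I_n) : 'M[C]_n :=
  x *: delta_mx i j + x^* *: delta_mx j i.

Lemma herm_delta_hermitian n x (i j : 'I_n) : herm_delta x i j \is hermsymmx.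
Proof.
rewrite is_hermitianmxE expr0 scale1r /herm_delta; apply/eqP/matrixP => k l.
rewrite !mxE !(rmorphD, rmorphM) /= conjCK !rmorph_nat addrC.
by rewrite ![(l == _) && _]andbC.
Qed.

Lemma form_herm_delta n x (i j : 'I_n) u v :
  '<u, v>_(herm_delta x i j) = x * u 0 i * (v 0 j)^* + x^* * u 0 j * (v 0 i)^*.
Proof.
have fd y k l : '<u, v>_(y *: delta_mx k l) = y * u 0 k * (v 0 l)^*.
  rewrite /form -scalemxAr -scalemxAl mxE -mulrA; congr (_ * _).
  rewrite -(mul_delta_mx (0 : 'I_1)) (mulmxA u) -(mulmxA (u *m _)).
  rewrite -colE -rowE mxE big_ord1.
  by rewrite !mxE.
by rewrite form_addmx !fd.
Qed.

End Completion.

(* [vk] is the vertex labelled k + 1, and likewise for the numbers in the names of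
   local vectors and coefficients: [n7] is n_8. *)
Local Notation v0 := (@Ordinal 8 0 isT).
Local Notation v1 := (@Ordinal 8 1 isT).
Local Notation v2 := (@Ordinal 8 2 isT).
Local Notation v3 := (@Ordinal 8 3 isT).
Local Notation v4 := (@Ordinal 8 4 isT).
Local Notation v5 := (@Ordinal 8 5 isT).
Local Notation v6 := (@Ordinal 8 6 isT).
Local Notation v7 := (@Ordinal 8 7 isT).

(** * The upper bound *)

Section Upper.
Variable C : numClosedFieldType.

Lemma solve_affine (a s : C) : (s = 0 -> a = 0) -> exists x, a + x * s = 0.
Proof.
have [->|s0 _] := eqVneq s 0; first by move=> /(_ erefl)->; exists 0; rewrite mulr0 addr0.
by exists (- a / s); rewrite divfK // subrr.
Qed.

Lemma proportional (s t x y : C) : (s != 0) || (t != 0) -> x * t = y * s ->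
  exists c, x = c * s /\ y = c * t.
Proof.
have [->|s0] := eqVneq s 0; last first.
  by move=> _ xy; exists (x / s); rewrite divfK // mulrAC xy mulfK.
rewrite mulr0 => /= t0 /eqP; rewrite mulf_eq0 (negbTE t0) orbF => /eqP->.
by exists (y / t); rewrite mulr0 divfK.
Qed.

Lemma form_missing (M : 'M[C]_8) x31 x75 x20 x64 u v :
  '<u, v>_(M + (herm_delta x31 v3 v1 + herm_delta x75 v7 v5
     + (herm_delta x20 v2 v0 + herm_delta x64 v6 v4))) =
  '<u, v>_M
  + (x31 * u 0 v3 * (v 0 v1)^* + x31^* * u 0 v1 * (v 0 v3)^*
  + (x75 * u 0 v7 * (v 0 v5)^* + x75^* * u 0 v5 * (v 0 v7)^*)
  + (x20 * u 0 v2 * (v 0 v0)^* + x20^* * u 0 v0 * (v 0 v2)^*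
  + (x64 * u 0 v6 * (v 0 v4)^* + x64^* * u 0 v4 * (v 0 v6)^*))).
Proof.
rewrite (form_addmx M) (form_addmx (herm_delta _ _ _ + _)).
by rewrite !(form_addmx (herm_delta _ _ _)) !form_herm_delta.
Qed.

Theorem G2_completable_within2 : completable_within C G2 2.
Proof.
move=> A Apos AG; have Ah : partial_hermitian A by case: Apos.
have A_G2 i j : specified A i j = (i == j) || G2 i j.
  have [->|ij] := eqVneq i j; last by rewrite AG.
  by case: Ah => /(_ j)[a Aj _] _ _; rewrite /specified Aj.
have psd M a b c d : completion A M ->
    all (fun i => all (fun j => (i == j) || G2 i j) [:: a; b; c; d]) [:: a; b; c; d] ->
    psd_on M (quad a b c d).
  move=> AM /allP cl; apply: (clique_psd_on Apos AM) => i j; rewrite !in_set => iK jK.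
  by rewrite A_G2; have /allP := cl i iK; apply.
set M0 := fill A; have M0h : M0 \is hermsymmx by exact: fill_hermitian.
have AM0 : completion A M0.
  by split=> // i j a E; rewrite mxE E.
pose Ka := quad v0 v4 v3 v7; pose Kb := quad v1 v5 v2 v6.
have ka := @supported_quad C 8 v0 v4 v3 v7; have kb := @supported_quad C 8 v1 v5 v2 v6.
have Kapos : psd_on M0 Ka by apply: psd.
have Kbpos : psd_on M0 Kb by apply: psd.
have [a7 [c7 [n70 n74]]] := psd_on_project2 M0h Kapos
  (ka v0 isT) (ka v4 isT) (ka v7 isT).
have [a3 [c3 [n30 n34]]] := psd_on_project2 M0h Kapos
  (ka v0 isT) (ka v4 isT) (ka v3 isT).
have [a6 [c6 [n61 n65]]] := psd_on_project2 M0h Kbpos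
  (kb v1 isT) (kb v5 isT) (kb v6 isT).
have [a2 [c2 [n21 n25]]] := psd_on_project2 M0h Kbpos
  (kb v1 isT) (kb v5 isT) (kb v2 isT).
set p7 := a7 *: _ + _ in n70 n74; set p3 := a3 *: _ + _ in n30 n34.
set p6 := a6 *: _ + _ in n61 n65; set p2 := a2 *: _ + _ in n21 n25.
set n7 := _ - p7 in n70 n74; set n3 := _ - p3 in n30 n34.
set n6 := _ - p6 in n61 n65; set n2 := _ - p2 in n21 n25.
have sup K u v w x y : supported K u -> supported K v -> supported K w ->
    supported K (w - (x *: u + y *: v) : 'rV[C]_8).
  by move=> ? ? ?; apply/supportedB/supportedD/supportedZ => //; apply/supportedZ.
have n7K : supported Ka n7 by apply: sup; exact: ka.
have n3K : supported Ka n3 by apply: sup; exact: ka.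
have n6K : supported Kb n6 by apply: sup; exact: kb.
have n2K : supported Kb n2 by apply: sup; exact: kb.
have n7E : n7 = 'e_v7 - p7 by []; have n3E : n3 = 'e_v3 - p3 by [].
have n6E : n6 = 'e_v6 - p6 by []; have n2E : n2 = 'e_v2 - p2 by [].
have p7E : p7 = a7 *: 'e_v0 + c7 *: 'e_v4 by [].
have p3E : p3 = a3 *: 'e_v0 + c3 *: 'e_v4 by [].
have p6E : p6 = a6 *: 'e_v1 + c6 *: 'e_v5 by [].
have p2E : p2 = a2 *: 'e_v1 + c2 *: 'e_v5 by [].
clearbody n7 n3 n6 n2; clearbody p7 p3 p6 p2.
have r_psd : psd2 '<n7, n7>_M0 '<n3, n3>_M0 '<n7, n3>_M0.
  move=> x y; rewrite -form_herm2 //.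
  by apply: Kapos; apply: supportedD; apply: supportedZ.
have s_psd : psd2 '<n6, n6>_M0 '<n2, n2>_M0 '<n6, n2>_M0.
  move=> x y; rewrite -form_herm2 //.
  by apply: Kbpos; apply: supportedD; apply: supportedZ.
(* The value of the completed form at the pair [(u, v)], where [u + p] and [v + q]
   are basis vectors: by orthogonality, the free entries cancel. *)
pose bil u p v q := '<u, v>_M0 + '<u, q>_M0 + '<p, v>_M0.
have [s7 [s3 [t6 [t2 [[s0 s3z s7z] [t0 t2z t6z] Ble]]]]] :=
  psd2_dominated (bil n7 p7 n6 p6, bil n7 p7 n2 p2, bil n3 p3 n6 p6, bil n3 p3 n2 p2)
    r_psd s_psd.
pose ns := s7 *: n7 + s3 *: n3; pose nt := t6 *: n6 + t2 *: n2.
(* The free entry at [(v3, v1)] enters with the coefficient [s3]. If [s3 = 0], admissibility makes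
   [n7] isotropic; it is supported on the clique of [v0], [v4], [v7], [v1], hence already orthogonal
   to ['e_v1]. The next three entries are found in the same way. *)
have [x31 x31E] : exists x, '<ns, 'e_v1>_M0 + x * s3 = 0.
  apply: solve_affine => s30; rewrite /ns s30 scale0r addr0 formZl.
  have K : psd_on M0 (quad v0 v4 v7 v1) by apply: psd.
  rewrite (psd_on_isotropic M0h K) ?mulr0 ?s3z //; last exact: supported_quad.
  by rewrite n7E p7E; apply: sup; exact: supported_quad.
have [x75 x75E] : exists x, '<ns, 'e_v5>_M0 + x * s7 = 0.
  apply: solve_affine => s70; rewrite /ns s70 scale0r add0r formZl.
  have K : psd_on M0 (quad v0 v4 v3 v5) by apply: psd.
  rewrite (psd_on_isotropic M0h K) ?mulr0 ?s7z //; last exact: supported_quad.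
  by rewrite n3E p3E; apply: sup; exact: supported_quad.
have [x20 x20E] : exists x, '<nt, 'e_v0>_M0 + x * t2 = 0.
  apply: solve_affine => t20; rewrite /nt t20 scale0r addr0 formZl.
  have K : psd_on M0 (quad v1 v5 v6 v0) by apply: psd.
  rewrite (psd_on_isotropic M0h K) ?mulr0 ?t2z //; last exact: supported_quad.
  by rewrite n6E p6E; apply: sup; exact: supported_quad.
have [x64 x64E] : exists x, '<nt, 'e_v4>_M0 + x * t6 = 0.
  apply: solve_affine => t60; rewrite /nt t60 scale0r add0r formZl.
  have K : psd_on M0 (quad v1 v5 v2 v4) by apply: psd.
  rewrite (psd_on_isotropic M0h K) ?mulr0 ?t6z //; last exact: supported_quad.
  by rewrite n2E p2E; apply: sup; exact: supported_quad.
pose Y := herm_delta x31 v3 v1 + herm_delta x75 v7 v5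
        + (herm_delta x20 v2 v0 + herm_delta x64 v6 v4).
have Yh : Y \is hermsymmx.
  by do 2 apply: hermitianD; exact: herm_delta_hermitian.
have AM : completion A (M0 + Y).
  apply: fill_completion => // i j; rewrite A_G2.
  case: i => [[|[|[|[|[|[|[|[|i]]]]]]]] ip] //;
  case: j => [[|[|[|[|[|[|[|[|j]]]]]]]] jp] //=;
  by rewrite !mxE /= ?mulr0 ?addr0.
have fM u v : '<u, v>_(M0 + Y) = _ := form_missing M0 x31 x75 x20 x64 u v.
have Mh := AM.1; move: (M0 + Y) AM Mh fM => M AM Mh fM.
pose ps := s7 *: p7 + s3 *: p3; pose qt := t6 *: p6 + t2 *: p2.
have bE : bilin2 (bil n7 p7 n6 p6, bil n7 p7 n2 p2, bil n3 p3 n6 p6, bil n3 p3 n2 p2)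
    s7 s3 t6 t2 = '<ns, nt>_M0 + '<ns, qt>_M0 + '<ps, nt>_M0.
  by rewrite /bilin2 /bil /ns /nt /ps /qt !(formDl, formDr, formZl, formZr); ring.
set al0 := s7 * a7 + s3 * a3; set al4 := s7 * c7 + s3 * c3.
set be1 := t6 * a6 + t2 * a2; set be5 := t6 * c6 + t2 * c2.
have psE : ps = al0 *: 'e_v0 + al4 *: 'e_v4.
  by rewrite /ps p7E p3E !scalerDr !scalerA addrACA -!scalerDl.
have qtE : qt = be1 *: 'e_v1 + be5 *: 'e_v5.
  by rewrite /qt p6E p2E !scalerDr !scalerA addrACA -!scalerDl.
have nsE : ns = s7 *: 'e_v7 + s3 *: 'e_v3 - ps.
  by rewrite /ns n7E n3E !scalerBr addrACA -opprD.
have ntE : nt = t6 *: 'e_v6 + t2 *: 'e_v2 - qt.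
  by rewrite /nt n6E n2E !scalerBr addrACA -opprD.
have ns0 : '<ns, 'e_v0>_M0 = 0 by rewrite formDl !formZl n70 n30 !mulr0 addr0.
have ns4 : '<ns, 'e_v4>_M0 = 0 by rewrite formDl !formZl n74 n34 !mulr0 addr0.
have nt1 : '<nt, 'e_v1>_M0 = 0 by rewrite formDl !formZl n61 n21 !mulr0 addr0.
have nt5 : '<nt, 'e_v5>_M0 = 0 by rewrite formDl !formZl n65 n25 !mulr0 addr0.
have nsc k : ns 0 k = s7 * (k == v7)%:R + s3 * (k == v3)%:R
    - (al0 * (k == v0)%:R + al4 * (k == v4)%:R).
  by rewrite nsE psE !mxE !eqxx.
have ntc k : nt 0 k = t6 * (k == v6)%:R + t2 * (k == v2)%:R
    - (be1 * (k == v1)%:R + be5 * (k == v5)%:R).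
  by rewrite ntE qtE !mxE !eqxx.
(* [ns] is supported on [Ka], and [nt] on [Kb]. Each set contains one end of every missing pair, so
   no free entry contributes. *)
have R_eq : '<ns, ns>_M = '<ns, ns>_M0.
  by rewrite fM !nsc /=; ring.
have S_eq : '<nt, nt>_M = '<nt, nt>_M0.
  by rewrite fM !ntc /=; ring.
have ns1 : '<ns, 'e_v1>_M0 = - (x31 * s3) by apply/eqP; rewrite -addr_eq0 x31E.
have ns5 : '<ns, 'e_v5>_M0 = - (x75 * s7) by apply/eqP; rewrite -addr_eq0 x75E.
have nt0 : '<nt, 'e_v0>_M0 = - (x20 * t2) by apply/eqP; rewrite -addr_eq0 x20E.
have nt4 : '<nt, 'e_v4>_M0 = - (x64 * t6) by apply/eqP; rewrite -addr_eq0 x64E.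
have R0 := form_herm2 n7 n3 s7 s3 M0h; rewrite -/ns in R0.
have S0 := form_herm2 n6 n2 t6 t2 M0h; rewrite -/nt in S0.
clearbody ns nt ps qt.
have B_eq : '<ns, nt>_M = '<ns, nt>_M0 + '<ns, qt>_M0 + '<ps, nt>_M0.
  rewrite fM psE qtE !(formDl, formDr, formZl, formZr) ns1 ns5.
  rewrite (form_conj nt 'e_v0) // nt0 (form_conj nt 'e_v4) // nt4 !ntc !nsc /=.
  rewrite !(rmorphM, rmorphN, rmorphD, rmorphB, rmorph0, rmorph1) /=.
  by ring.
have ns_orth : {in quad v0 v4 v1 v5, forall j, '<ns, 'e_j>_M = 0}.
  by apply: all_quad; rewrite fM !nsc !mxE /= ?ns0 ?ns4 ?ns1 ?ns5 ?rmorph0 ?rmorph1; ring.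
have nt_orth : {in quad v0 v4 v1 v5, forall j, '<nt, 'e_j>_M = 0}.
  by apply: all_quad; rewrite fM !ntc !mxE /= ?nt0 ?nt4 ?nt1 ?nt5 ?rmorph0 ?rmorph1; ring.
exists M => //.
(* The two equations make the coordinates at [v7], [v3] proportional to [s7], [s3] and those at
   [v6], [v2] proportional to [t6], [t2]. They cut out the span of [ns], [nt] and the basis vectors
   at [v0], [v4], [v1], [v5]. *)
pose L : 'M[C]_(8, 1 + 1) := row_mx (s3 *: delta_mx v7 0 - s7 *: delta_mx v3 0)
  (t2 *: delta_mx v6 0 - t6 *: delta_mx v2 0).
apply: (@i_minus_leq _ _ (1 + 1) _ L) => // v.
rewrite mul_mx_row -row_mx0 !mulmxBr -!scalemxAr -!colE => /eq_row_mx[].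
move=> /matrixP/(_ 0 0); rewrite !mxE => /subr0_eq Ls.
move=> /matrixP/(_ 0 0); rewrite !mxE => /subr0_eq Lt.
have [l [l7 l3]] := proportional s0 (etrans (mulrC _ _) (etrans Ls (mulrC _ _))).
have [m [m6 m2]] := proportional t0 (etrans (mulrC _ _) (etrans Lt (mulrC _ _))).
(* The remainder [w] is supported on a clique and orthogonal to [u]. The form at [v] is thus a
   clique value plus a value of the 2x2 block. *)
pose u := l *: ns + m *: nt; pose w := v - u.
have wc k : w 0 k = v 0 k - (l * ns 0 k + m * nt 0 k) by rewrite !mxE.
have wK : supported (quad v0 v4 v1 v5) w.
  case=> [[|[|[|[|[|[|[|[|i]]]]]]]] ip] //; rewrite !inE //= => _.
  - by rewrite (_ : Ordinal ip = v2) ?wc ?nsc ?ntc ?m2 /=; [ring | exact: val_inj].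
  - by rewrite (_ : Ordinal ip = v3) ?wc ?nsc ?ntc ?l3 /=; [ring | exact: val_inj].
  - by rewrite (_ : Ordinal ip = v6) ?wc ?nsc ?ntc ?m6 /=; [ring | exact: val_inj].
  by rewrite (_ : Ordinal ip = v7) ?wc ?nsc ?ntc ?l7 /=; [ring | exact: val_inj].
have uw : '<u, w>_M = 0.
  rewrite formDl !formZl (form_supported0 wK ns_orth) (form_supported0 wK nt_orth).
  by rewrite !mulr0 addr0.
rewrite -[v](subrK u) -/w form_add_orthogonal // addr_ge0 //.
  by apply: psd wK.
rewrite form_herm2 // R_eq S_eq B_eq -bE R0 S0.
by apply: herm2_ge0.
Qed.

End Upper.

(** * The lower bound *)

Section Lower.
Variable C : numClosedFieldType.

(** Indices run from 0 to 7. Within a block, distance 3 singles out the edge that closes the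
    4-cycle. *)
Definition two_cycles_entry (i j : nat) : C :=
  if i == j then 1 else if (i < 4)%N != (j < 4)%N then 0
  else if `|i - j|%N == 3 then -1 else 1.

Definition two_cycles : pmatrix C 8 :=
  \matrix_(i, j) if (i == j) || G2 i j then Some (two_cycles_entry i j) else None.

Lemma two_cycles_entry_sym i j : two_cycles_entry i j = two_cycles_entry j i.
Proof. by rewrite /two_cycles_entry eq_sym distnC [(j < 4)%N == _]eq_sym. Qed.

Lemma two_cycles_entry_conj i j : (two_cycles_entry i j)^* = two_cycles_entry i j.
Proof. by rewrite /two_cycles_entry; do !case: ifP => _; rewrite ?rmorphN ?rmorph1 ?rmorph0. Qed.

Lemma two_cycles_specified i j : specified two_cycles i j = (i == j) || G2 i j.
Proof. by rewrite /specified mxE; case: ifP. Qed.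

Lemma two_cycles_hermitian : partial_hermitian two_cycles.
Proof.
split.
- by move=> i; exists 1; rewrite ?mxE ?eqxx ?rpred1 // /two_cycles_entry eqxx.
- by move=> i j; rewrite !two_cycles_specified eq_sym adj_sym.
move=> i j a b; rewrite !mxE eq_sym adj_sym; case: ifP => // _ [<-] [<-].
by rewrite two_cycles_entry_conj two_cycles_entry_sym.
Qed.

Definition cycle_form (a b c d : C) : C :=
  a * a^* + b * b^* + c * c^* + d * d^* + a * b^* + b * a^* + b * c^* + c * b^*
  + c * d^* + d * c^* - a * d^* - d * a^*.

(** The two remaining coordinates are adjacent on the cycle, and the form is the squared modulus of
    their sum, or of their difference on the edge with entry -1. *)
Lemma cycle_form_ge0 a b c d : a = 0 \/ c = 0 -> b = 0 \/ d = 0 ->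
  0 <= cycle_form a b c d.
Proof.
have square (x e : C) : e = x * x^* -> 0 <= e by move->; rewrite -normCK exprn_ge0.
rewrite /cycle_form => -[]-> []->; rewrite rmorph0.
- by apply: (square (c + d)); rewrite rmorphD; ring.
- by apply: (square (b + c)); rewrite rmorphD; ring.
- by apply: (square (a - d)); rewrite rmorphB; ring.
by apply: (square (a + b)); rewrite rmorphD; ring.
Qed.

Lemma form_two_cycles (u : 'rV[C]_8) : let x k := u 0 (inord k) in
  '<u, u>_(fill two_cycles) = cycle_form (x 0) (x 1) (x 2) (x 3)
                      + cycle_form (x 4) (x 5) (x 6) (x 7).
Proof.
move=> x; pose F i j := x i *
  (if (i == j) || ((i.+1, j.+1) \notin E2c) && ((j.+1, i.+1) \notin E2c)
   then two_cycles_entry i j else 0) * (x j)^*.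
have -> : '<u, u>_(fill two_cycles) = \sum_(j < 8) \sum_(i < 8) F i j.
  rewrite {1}/form mxE; apply: eq_bigr => j _; rewrite mxE mulr_suml.
  apply: eq_bigr => i _; rewrite /F /x !inord_val !mxE /= /G2_adj; congr (_ * _ * _).
  by rewrite -val_eqE; case: (_ == _ :> nat) => //=; case: ifP.
rewrite !big_ord_recr !big_ord0 /= /F /= /two_cycles_entry /=.
by rewrite /cycle_form; ring.
Qed.

Lemma two_cycles_positive : partial_positive two_cycles.
Proof.
split=> [|K Kcl]; first exact: two_cycles_hermitian.
have -> : principal_submx two_cycles K =
    mxsub (@enum_val _ (mem K)) (@enum_val _ (mem K)) (fill two_cycles).
  by apply/matrixP => i j; rewrite !mxE.
have Mh := fill_hermitian two_cycles_hermitian.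
split.
  have := is_hermitianmxP _ _ _ Mh; rewrite is_hermitianmxE expr0 !scale1r => E.
  by rewrite {1}E; apply/eqP/matrixP => i j; rewrite !mxE.
move=> v; rewrite -{2}[v]trmxCK mxsub_form; set u := _ *m _.
have uK : supported K u by exact: rowsub_supported.
(* A clique misses an end of each unspecified pair, which supplies the hypotheses of
   [cycle_form_ge0]. *)
have x0 i j : ~~ specified two_cycles i j -> u 0 i = 0 \/ u 0 j = 0.
  move=> ij; have [iK|/uK] := boolP (i \in K); last by left.
  have [jK|/uK] := boolP (j \in K); last by right.
  by rewrite Kcl in ij.
rewrite form_two_cycles addr_ge0 // cycle_form_ge0 //; apply: x0;
  by rewrite two_cycles_specified /= /G2_adj -!val_eqE /= !inordK.
Qed.

(** Both ['e_a + 'e_d] and ['e_a - 'e_b] are isotropic. Their products with ['e_c] are [M a c + 1]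
    and [M a c - 1], which cannot both vanish, so [form_lt0] applies to one of them. *)
Lemma cycle_negative n (M : 'M[C]_n) a b c d : M \is hermsymmx ->
  M a a = 1 -> M b b = 1 -> M d d = 1 ->
  M a b = 1 -> M b c = 1 -> M c d = 1 -> M a d = -1 ->
  exists2 v, supported (quad a b c d) v & '<v, v>_M < 0.
Proof.
move=> Mh Maa Mbb Mdd Mab Mbc Mcd Mad.
have Mc i j : M j i = (M i j)^* by rewrite -!(formee Num.conj) form_conj.
have [Mac|Mac] := eqVneq (M a c) 1.
  have [||z zneg] := @form_lt0 _ _ M ('e_a + 'e_d) 'e_c Mh.
  - rewrite !(formDl, formDr) !formee (Mc a d) Maa Mdd Mad rmorphN rmorph1; ring.
  - by rewrite formDl !formee (Mc c d) Mac Mcd rmorph1 -[1 + 1]/(2%:R) pnatr_eq0.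
  exists (z *: ('e_a + 'e_d) + 'e_c) => //.
  by apply/supportedD/supported_quad;
    [apply/supportedZ/supportedD; apply: supported_quad|];
    rewrite !inE eqxx ?orbT.
have [||z zneg] := @form_lt0 _ _ M ('e_a - 'e_b) 'e_c Mh.
- rewrite !(formDl, formDr, formNl, formNr) !formee (Mc a b) Maa Mbb Mab rmorph1; ring.
- by rewrite formDl formNl !formee Mbc subr_eq0.
exists (z *: ('e_a - 'e_b) + 'e_c) => //.
by apply/supportedD/supported_quad;
    [apply/supportedZ/supportedB; apply: supported_quad|];
    rewrite !inE eqxx ?orbT.
Qed.

Theorem G2_completable_within_ge2 k : completable_within C G2 k -> (2 <= k)%N.
Proof.
move=> /(_ two_cycles two_cycles_positive)[|M [Mh MA] Mk].
  by move=> i j ij; rewrite two_cycles_specified (negbTE ij).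
have ME i j : (i == j) || G2 i j -> M i j = two_cycles_entry i j.
  by move=> ij; apply: MA; rewrite mxE ij.
apply: leq_trans Mk.
have [u uK uneg] : exists2 v, supported (quad v0 v1 v2 v3) v & '<v, v>_M < 0.
  by apply: cycle_negative; rewrite ?ME.
have [v vK vneg] : exists2 v, supported (quad v4 v5 v6 v7) v & '<v, v>_M < 0.
  by apply: cycle_negative; rewrite ?ME.
apply: (leq2_i_minus Mh _ uneg vneg).
(* All pairs between the two cycles are specified with entry 0, so the two negative vectors are
   orthogonal in any completion. *)
apply: (form_supported0 vK) => j jK; rewrite (form_conj 'e_j) //.
rewrite (form_supported0 uK) ?rmorph0 // => i iK.
rewrite formee; move: j jK i iK.
by do 2 apply: all_quad; rewrite ME.
Qed.

End Lower.

Theorem proposition1p4 (R : realType) : is_completion_number R[i] G2 2.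
Proof.
split; first exact: G2_completable_within2.
exact: G2_completable_within_ge2.
Qed.
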